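(* Let $\Lambda$ be a linear functional on $\widehat{\mathcal D}^+_0=\mathcal D^+_0\oplus\mathbb C C$, and let $L(\widehat{\mathcal D}^+;\Lambda)$ be the irreducible highest weight $\widehat{\mathcal D}^+$-module with highest weight $\Lambda$. Define $\Delta^+_n=-\Lambda((D+1/2)^n)$ for odd $n\ge1$ and $\Delta^+_\Lambda(x)=\sum_{n\ \mathrm{odd}\ \ge1}\frac{x^n}{n!}\Delta^+_n$. Then $L(\widehat{\mathcal D}^+;\Lambda)$ is quasifinite if and only if $\Delta^+_\Lambda(x)=\dfrac{F(x)}{2\sinh(x/2)}$ for some even quasipolynomial $F(x)$ with $F(0)=0$.
   Context: $\mathcal D$ is the Lie algebra of differential operators $t^kf(D)$ on the circle ($D=t\frac d{dt}$, $f$ polynomial, $f(D)t^s=t^sf(D+s)$). $\widehat{\mathcal D}=\mathcal D\oplus\mathbb CC$ with $[t^rf(D),t^sg(D)]=t^{r+s}(f(D+s)g(D)-f(D)g(D+r))+\Psi(t^rf(D),t^sg(D))C$, where $\Psi=0$ if $r+s\ne0$, $\Psi(t^rf(D),t^{-r}g(D))=\sum_{-r\le j\le-1}f(j)g(j+r)$ for $r\ge0$ (and $\Psi$ is antisymmetric). $\mathcal D^+=\{a\in\mathcal D:\sigma(a)=-a\}$ where $\sigma$ is the anti-involution with $t\mapsto t$, $D\mapsto -D-1$; $\widehat{\mathcal D}^+=\mathcal D^+\oplus\mathbb CC\subset\widehat{\mathcal D}$. Grading: $\deg t^kf(D)=k$, $\deg C=0$; $\widehat{\mathcal D}^+_{\pm}$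 = sum of positive/negative degree parts; $\mathcal D^+_0=\{g(D+1/2):g\text{ odd polynomial}\}$. A highest weight module is generated by a vector annihilated by $\widehat{\mathcal D}^+_+$ on which $\widehat{\mathcal D}^+_0$ acts by $\Lambda$; $L(\widehat{\mathcal D}^+;\Lambda)$ is the irreducible quotient of the Verma module. A graded module $V=\oplus_jV_j$ is quasifinite if every $V_j$ is finite dimensional. A quasipolynomial is a finite linear combination of functions $p(x)e^{\alpha x}$, $p$ polynomial, $\alpha\in\mathbb C$. *)

(* Defs.v *)
From HB Require Import structures.
From mathcomp Require Import all_boot all_order all_algebra.
From mathcomp Require Import complex.
From mathcomp Require Import Rstruct.
Set Implicit Arguments. Unset Strict Implicit. Unset Printing Implicit Defensive.
Import Order.TTheory GRing.Theory Num.Theory.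
Local Open Scope ring_scope.

Notation Cx := (complex Rdefinitions.R).

(* An element t^k f(D) of D is encoded by the pair (k, f), f : {poly Cx}. *)
(* D = (+)_k t^k C[D]; the anti-involution sigma (t -> t, D -> -D-1)       *)
(* sends t^k f(D) to f(-D-1) t^k = t^k f(-D-1-k).  Hence the homogeneous   *)
(* component D^+_k of degree k is { t^k f(D) : f(-D-1-k) = - f(D) }.       *)
Definition Dplus (k : int) (f : {poly Cx}) : Prop :=
  f \Po (- 'X - (k%:~R + 1)%:P) = - f.

(* t^{r+s} (f(D+s) g(D) - f(D) g(D+r)) = [t^r f(D), t^s g(D)] modulo C *)
Definition bracket_poly (r : int) (f : {poly Cx}) (s : int) (g : {poly Cx})
  : {poly Cx} :=
  (f \Po ('X + (s%:~R)%:P)) * g - f * (g \Po ('X + (r%:~R)%:P)).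

Definition psi0 (n : nat) (f g : {poly Cx}) : Cx :=
  \sum_(i < n) f.[- (i.+1)%:R] * g.[(n - i.+1)%:R].

Definition Psi (r : int) (f : {poly Cx}) (s : int) (g : {poly Cx}) : Cx :=
  if r + s != 0 then 0
  else if (0 <= r)%R then psi0 `|r|%N f g else - psi0 `|r|%N g f.

(* A representation of \hat D^+ = (+)_k D^+_k (+) C C on a complex vector
   space V, given by the (linear) actions rho k (on D^+_k) and rhoC (of C). *)
Definition is_DhatPlus_module (V : lmodType Cx)
    (rho : int -> {poly Cx} -> V -> V) (rhoC : V -> V) : Prop :=
  [/\ (forall k f, Dplus k f ->
         forall (a : Cx) (x y : V), rho k f (a *: x + y) = a *: rho k f x + rho k f y),
      (forall (a : Cx) (x y : V), rhoC (a *: x + y) = a *: rhoC x + rhoC y),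
      (forall k f g (a : Cx) (x : V), Dplus k f -> Dplus k g ->
         rho k (a *: f + g) x = a *: rho k f x + rho k g x),
      (forall k f (x : V), Dplus k f -> rhoC (rho k f x) = rho k f (rhoC x))
    & (forall r f s g (x : V), Dplus r f -> Dplus s g ->
         rho r f (rho s g x) - rho s g (rho r f x)
         = rho (r + s) (bracket_poly r f s g) x + Psi r f s g *: rhoC x)].

Definition is_word (w : seq (int * {poly Cx})) : Prop :=
  List.Forall (fun p => Dplus p.1 p.2) w.

Definition act (V : lmodType Cx) (rho : int -> {poly Cx} -> V -> V)
    (w : seq (int * {poly Cx})) (v : V) : V :=
  foldr (fun p x => rho p.1 p.2 x) v w.

Definition wdeg (w : seq (int * {poly Cx})) : int := \sum_(p <- w) p.1.

Definition in_span (V : lmodType Cx) (S : V -> Prop) (x : V) : Prop :=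
  exists l : seq (Cx * V),
    List.Forall (fun p => S p.2) l /\ x = \sum_(p <- l) p.1 *: p.2.

Definition is_submodule (V : lmodType Cx) (rho : int -> {poly Cx} -> V -> V)
    (rhoC : V -> V) (W : V -> Prop) : Prop :=
  [/\ W 0,
      (forall (a : Cx) x y, W x -> W y -> W (a *: x + y)),
      (forall k f x, Dplus k f -> W x -> W (rho k f x))
    & (forall x, W x -> W (rhoC x))].

Definition irreducible_module (V : lmodType Cx) (rho : int -> {poly Cx} -> V -> V)
    (rhoC : V -> V) : Prop :=
  (exists x : V, x != 0) /\
  forall W, is_submodule rho rhoC W -> (exists x, W x /\ x != 0) -> forall x, W x.

(* V is a highest weight module with highest weight Lambda = (Lambda0, c),
   Lambda0 = Lambda on D^+_0, c = Lambda(C), highest weight vector v. *)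
Definition is_highest_weight_module (V : lmodType Cx)
    (rho : int -> {poly Cx} -> V -> V) (rhoC : V -> V)
    (Lambda0 : {poly Cx} -> Cx) (c : Cx) (v : V) : Prop :=
  [/\ v != 0,
      (forall k f, (0 < k)%R -> Dplus k f -> rho k f v = 0),
      (forall f, Dplus 0 f -> rho 0 f v = Lambda0 f *: v),
      rhoC v = c *: v
    & (forall x, in_span (fun y => exists w, is_word w /\ y = act rho w v) x)].

(* quasifinite: each graded piece V_j = span{ a_1 ... a_m v : a_i homogeneous,
   sum deg a_i = j } is finite dimensional *)
Definition quasifinite (V : lmodType Cx) (rho : int -> {poly Cx} -> V -> V)
    (v : V) : Prop :=
  forall j : int, exists B : seq V,
    forall w, is_word w -> wdeg w = j -> in_span (fun y => y \in B) (act rho w v).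

(* Generating series (formal power series = coefficient sequences).       *)
Definition DeltaP (Lambda0 : {poly Cx} -> Cx) (n : nat) : Cx :=
  - Lambda0 (('X + (2%:R^-1)%:P) ^+ n).

Definition DeltaSeries (Lambda0 : {poly Cx} -> Cx) (n : nat) : Cx :=
  if odd n then DeltaP Lambda0 n / (n`!)%:R else 0.

(* coefficient of x^n in 2 sinh(x/2) *)
Definition sinh2_coef (n : nat) : Cx :=
  if odd n then 2%:R * (2%:R^-1) ^+ n / (n`!)%:R else 0.

(* A quasipolynomial F(x) = sum_i p_i(x) e^{alpha_i x} is given by the list
   of pairs (alpha_i, p_i); qp_coef F n is the coefficient of x^n in its
   Taylor expansion: sum_i sum_{k<=n} (p_i)_k alpha_i^(n-k)/(n-k)!. *)
Definition qp_coef (F : seq (Cx * {poly Cx})) (n : nat) : Cx :=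
  \sum_(q <- F) \sum_(k < n.+1) q.2`_k * q.1 ^+ (n - k) / ((n - k)`!)%:R.

(* Main.v *)
Require Import Defs.
From HB Require Import structures.
From mathcomp Require Import all_boot all_order all_algebra.
From mathcomp Require Import complex.
From mathcomp Require Import Rstruct.
From mathcomp Require Import ring zify.
Import Order.TTheory GRing.Theory Num.Theory.
Local Open Scope ring_scope.
Set Implicit Arguments. Unset Strict Implicit. Unset Printing Implicit Defensive.

(** Let [phi(h) = Lambda(h(D) - h(D+1))].  Up to the factor [1/n!], [phi(D^n)] is
    the coefficient of [x^n] in [2 sinh(x/2) Delta(x)], so this product is a
    quasipolynomial iff [phi] vanishes on a nonzero ideal of [C[D]].

    For odd [g] and [b], [t g(D+1)] maps [t^{-1} b(D) v] to [phi(g b) v].  If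
    [L_{-1}] is finite dimensional, some [t^{-1} b(D)] with [b] odd and nonzero
    kills [v], hence [phi] vanishes on the ideal of [b].  Conversely, if [phi]
    vanishes on the ideal of [p], take [b = D p(D) p(-D)]: then [t^{-1} b(D) v] is
    singular, so it is [0] by irreducibility, the operator [D + 1/2] separating
    degrees.  Commuting with degree [0] and with [t^{-1} b(D)] shows that every
    [D^+_{-k} v] is finite dimensional; this property passes from [v] to all of [L],
    and the graded pieces are then finite dimensional by induction on the degree. *)

(** * Functionals on polynomials and quasipolynomials *)

Lemma lmorph0 (K : pzRingType) (U W : lmodType K) (f : U -> W) :
  (forall c u w, f (c *: u + w) = c *: f u + f w) -> f 0 = 0.
Proof. by move=> f_lin; have := f_lin (-1) 0 0; rewrite scaler0 addr0 scaleN1r addNr. Qed.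

Lemma lmorph_sum (K : pzRingType) (U W : lmodType K) (f : U -> W) (I : Type)
    (s : seq I) (a : I -> K) (x : I -> U) :
  (forall c u w, f (c *: u + w) = c *: f u + f w) ->
  f (\sum_(i <- s) a i *: x i) = \sum_(i <- s) a i *: f (x i).
Proof.
move=> f_lin; elim: s => [|i s IHs]; last by rewrite !big_cons f_lin IHs.
by rewrite !big_nil lmorph0.
Qed.

(** Factoring the difference of powers leaves [c] times a sum of [n.+1] monic polynomials of degree
    [n]. *)
Lemma coef_shift_diff (K : numFieldType) (c : K) n j : (n <= j)%N ->
  (('X + c%:P) ^+ n.+1 - 'X^(n.+1) : {poly K})`_j = if j == n then c *+ n.+1 else 0.
Proof.
move=> le_nj; rewrite subrXX addrAC subrr add0r coefCM coef_sum /=.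
have mon (i : 'I_n.+1) : ('X + c%:P) ^+ (n - i) * 'X^i \is @monic K.
  by rewrite monicMl ?monicXn // monic_exp // monicXaddC.
have sz (i : 'I_n.+1) : size (('X + c%:P) ^+ (n - i) * 'X^i : {poly K}) = n.+1.
  rewrite size_mulXn; last by rewrite -size_poly_gt0 -[c]opprK polyCN size_exp_XsubC.
  by rewrite -[c]opprK polyCN size_exp_XsubC; have := ltn_ord i; lia.
case: eqP => [->|/eqP ne_jn].
  rewrite (eq_bigr (fun _ => 1)) ?sumr_const ?card_ord ?mulr_natr //.
  by move=> i _; have /monicP := mon i; rewrite lead_coefE sz.
rewrite big1 ?mulr0 // => i _; rewrite nth_default // sz.
by rewrite ltn_neqAle eq_sym ne_jn.
Qed.

(** The difference of ['X^(n.+1)] has degree [n] and leading coefficient [c *+ n.+1], nonzero in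
    characteristic 0, so top coefficients can be removed one at a time. *)
Lemma shift_diff_surj (K : numFieldType) (c : K) (h : {poly K}) : c != 0 ->
  exists g, g \Po ('X + c%:P) - g = h.
Proof.
move=> c0; move: {2}(size h) (leqnn (size h)) => n; elim: n h => [|n IHn] h sz_h.
  exists 0; rewrite comp_poly0 subr0; apply/esym/eqP.
  by rewrite -size_poly_leq0.
pose a := h`_n / (c *+ n.+1).
pose d := ('X + c%:P) ^+ n.+1 - 'X^(n.+1) : {poly K}.
have [|g def_g] := IHn (h - a *: d).
  apply/leq_sizeP => j le_nj; rewrite coefB coefZ coef_shift_diff //.
  case: eqP => [->|/eqP ne_jn].
    by rewrite divfK ?subrr // -mulr_natr mulf_neq0 // pnatr_eq0.
  by rewrite mulr0 subr0 nth_default // (leq_trans sz_h) // ltn_neqAle eq_sym ne_jn.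
exists (g + a *: 'X^(n.+1)).
rewrite comp_polyD comp_polyZ rmorphXn /= comp_polyX opprD.
by rewrite addrACA def_g -scalerBr subrK.
Qed.

(** For nonzero [c], [c^-1 *: p] is a solution up to a multiple of the derivative of [p], which has
    smaller degree; for [c = 0] an antiderivative works. *)
Lemma linear_ode_poly (K : numFieldType) (c : K) (p : {poly K}) :
  exists q, q^`() + c *: q = p.
Proof.
have [->|c0] := eqVneq c 0.
  exists (\poly_(i < (size p).+1) (p`_i.-1 / i%:R)); rewrite scale0r addr0.
  apply/polyP => i; rewrite coef_deriv coef_poly /= ltnS.
  have [lt_ip|le_pi] := ltnP; last by rewrite mul0rn nth_default.
  by rewrite -[LHS]mulr_natr divfK // pnatr_eq0.
move: {2}(size p) (leqnn (size p)) => n; elim: n p => [|n IHn] p sz_p.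
  by exists 0; rewrite deriv0 scaler0 addr0; apply/esym/eqP; rewrite -size_poly_leq0.
have [|q def_q] := IHn (- (c^-1 *: p^`())).
  rewrite size_polyN (leq_trans (size_scale_leq _ _)) //.
  have [->|p0] := eqVneq p 0; first by rewrite deriv0 size_poly0.
  by rewrite -ltnS (leq_trans (lt_size_deriv p0)).
exists (q + c^-1 *: p).
by rewrite derivD derivZ scalerDr addrACA def_q addKr scalerA divff // scale1r.
Qed.


(* [qp_pair b q h] is the value at [h] of the functional on polynomials whose
   exponential generating function is [q(x) e^{bx}]. *)
Definition qp_pair (K : nzRingType) (b : K) (q h : {poly K}) : K :=
  \sum_(k < size q) q`_k * h^`(k).[b].

Lemma qp_pair_widen (K : nzRingType) (b : K) (q h : {poly K}) n :
  (size q <= n)%N -> qp_pair b q h = \sum_(k < n) q`_k * h^`(k).[b].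
Proof.
move=> le_qn; rewrite /qp_pair (big_ord_widen n (fun k => q`_k * h^`(k).[b])) //.
rewrite big_mkcond; apply: eq_bigr => i _.
by case: ltnP => // le_qi; rewrite nth_default // mul0r.
Qed.

Lemma qp_pair_linl (K : nzRingType) (b a : K) (q r h : {poly K}) :
  qp_pair b (a *: q + r) h = a * qp_pair b q h + qp_pair b r h.
Proof.
pose n := maxn (size (a *: q + r)) (maxn (size q) (size r)).
rewrite !(@qp_pair_widen _ _ _ _ n) ?leq_max ?leqnn ?orbT //.
rewrite mulr_sumr -big_split; apply: eq_bigr => i _.
by rewrite coefD coefZ mulrDl mulrA.
Qed.

Lemma qp_pair_linr (K : comNzRingType) (b a : K) (q g h : {poly K}) :
  qp_pair b q (a *: g + h) = a * qp_pair b q g + qp_pair b q h.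
Proof.
rewrite /qp_pair mulr_sumr -big_split; apply: eq_bigr => i _ /=.
by rewrite derivnD derivnZ hornerD hornerZ mulrDr mulrCA.
Qed.

(** Multiplying the argument by ['X] differentiates the generating function, and (q e^{bx})' = (b q
    + q') e^{bx}. *)
Lemma qp_pairMX (K : comNzRingType) (b : K) (q h : {poly K}) :
  qp_pair b q (h * 'X) = b * qp_pair b q h + qp_pair b q^`() h.
Proof.
rewrite !(@qp_pair_widen _ _ q _ (size q).+1) // (@qp_pair_widen _ _ q^`() _ (size q)); last first.
  have [->|q0] := eqVneq q 0; first by rewrite deriv0 size_poly0.
  exact/ltnW/lt_size_deriv.
rewrite !big_ord_recl !derivn0 hornerMX mulrDr -addrA; congr (_ + _); first ring.
rewrite mulr_sumr -big_split; apply: eq_bigr => i _; rewrite lift0.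
have := derivnMXaddC i h 0; rewrite polyC0 addr0 => ->.
rewrite coef_deriv hornerD hornerMX hornerMn.
by rewrite mulrnAl mulrDr mulrnAr addrC; congr (_ + _); ring.
Qed.

Definition qp_functional (K : nzRingType) (F : seq (K * {poly K})) (h : {poly K}) : K :=
  \sum_(q <- F) qp_pair q.1 q.2 h.

(** Only derivatives at [b] of order below [size q] enter, and each vanishes on multiples of this
    power. *)
Lemma qp_pair_root_exp (K : fieldType) (b : K) (q h : {poly K}) :
  qp_pair b q (('X - b%:P) ^+ size q * h) = 0.
Proof.
rewrite /qp_pair big1 // => -[k lt_kq] _ /=; move: (size q) lt_kq q`_k h => n + a h.
move=> {q} lt_kn; suff ->: (('X - b%:P) ^+ n * h)^`(k).[b] = 0 by rewrite mulr0.
elim: k n h lt_kn => [|k IHk] [|n] h lt_kn //; rewrite ?derivn0 ?derivSn.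
  by rewrite exprS !hornerE subrr !mul0r.
rewrite derivM deriv_exp derivXsubC mul1r.
have -> : ('X - b%:P) ^+ n.+1.-1 *+ n.+1 * h + ('X - b%:P) ^+ n.+1 * h^`() =
   ('X - b%:P) ^+ n * (h *+ n.+1 + ('X - b%:P) * h^`()).
  by rewrite exprS; ring.
exact: IHk.
Qed.

Lemma poly_functional_ext (K : comNzRingType) (f g : {poly K} -> K) :
  (forall a p q, f (a *: p + q) = a * f p + f q) ->
  (forall a p q, g (a *: p + q) = a * g p + g q) ->
  (forall n, f 'X^n = g 'X^n) -> f =1 g.
Proof.
move=> f_lin g_lin fg p; rewrite -[p]coefK poly_def.
rewrite (@lmorph_sum K {poly K} K^o f) ?(@lmorph_sum K {poly K} K^o g) //.
by apply: eq_bigr => i _; rewrite fg.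
Qed.

Lemma qp_functional_annihilator (K : fieldType) (F : seq (K * {poly K})) :
  exists2 p : {poly K}, p != 0 & forall h, qp_functional F (p * h) = 0.
Proof.
exists (\prod_(q <- F) ('X - q.1%:P) ^+ size q.2).
  rewrite prodf_seq_neq0; apply/allP => q _ /=.
  by rewrite expf_neq0 // polyXsubC_eq0.
rewrite /qp_functional; elim: F => [|q F IHF] h; first by rewrite !big_nil.
rewrite !big_cons -mulrA qp_pair_root_exp add0r.
by rewrite mulrCA; apply: IHF.
Qed.

(** Term by term, f' - c f = p e^{bx} is solved by f = q e^{bx} with q' + (b - c) q = p. *)
Lemma qp_functional_ode (K : numFieldType) (c : K) (F : seq (K * {poly K})) :
  exists G, forall h, qp_functional G (h * 'X) - c * qp_functional G h = qp_functional F h.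
Proof.
rewrite /qp_functional; elim: F => [|[b p] F [G defG]].
  by exists [::] => h; rewrite !big_nil mulr0 subr0.
have [q def_q] := linear_ode_poly (b - c) p.
exists ((b, q) :: G) => h; rewrite !big_cons /= -defG qp_pairMX -def_q.
by rewrite [q^`() + _]addrC qp_pair_linl; ring.
Qed.

(* An annihilating polynomial [('X - c) p] makes the generating function [f] a
   solution of [f' - c f = g] with [g] annihilated by [p]. *)
Lemma annihilated_prod_qp (K : numFieldType) (rs : seq K) (f : {poly K} -> K) :
  (forall a p q, f (a *: p + q) = a * f p + f q) ->
  (forall h, f (\prod_(z <- rs) ('X - z%:P) * h) = 0) ->
  exists F, forall n, f 'X^n = qp_functional F 'X^n.
Proof.
elim: rs f => [|c rs IHrs] f f_lin f_ann.
  exists [::] => n; rewrite /qp_functional big_nil.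
  by rewrite -(f_ann 'X^n) big_nil mul1r.
have [||F defF] := IHrs (fun h => f (('X - c%:P) * h)).
- by move=> a p q; rewrite mulrDr -scalerAr f_lin.
- by move=> h; rewrite mulrA -(f_ann h) big_cons.
have [G defG] := qp_functional_ode c F.
(* [G] is a particular solution; a multiple of e^{cx}, which solves the homogeneous equation,
   corrects the value at [1]. *)
exists ((c, (f 1 - qp_functional G 1)%:P) :: G) => n.
have pairC a h : qp_pair c a%:P h = a * h.[c].
  rewrite (@qp_pair_widen _ _ _ _ 1) ?size_polyC ?leq_b1 //.
  by rewrite big_ord_recl big_ord0 addr0 derivn0 coefC.
rewrite [RHS]big_cons pairC /= -[\sum_(q <- G) _]/(qp_functional G _).
elim: n => [|n IHn]; first by rewrite expr0 hornerC; ring.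
have fS : f 'X^(n.+1) = c * f 'X^n + f (('X - c%:P) * 'X^n).
  by rewrite -f_lin -mul_polyC exprS; congr f; ring.
rewrite fS IHn defF -defG !hornerXn -exprSr [c ^+ n.+1]exprS; ring.
Qed.

Lemma annihilated_qp (K : numClosedFieldType) (f : {poly K} -> K) (p : {poly K}) :
  (forall a p q, f (a *: p + q) = a * f p + f q) ->
  p != 0 -> (forall h, f (p * h) = 0) ->
  exists F, forall n, f 'X^n = qp_functional F 'X^n.
Proof.
move=> f_lin p0 f_ann; have [rs def_p] := closed_field_poly_normal p.
apply: (annihilated_prod_qp (rs := rs)) => // h.
rewrite -(f_ann ((lead_coef p)^-1 *: h)) [X in _ = f (X * _)]def_p.
by rewrite -scalerAr -scalerAl scalerA mulVf ?scale1r // lead_coef_eq0.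
Qed.

(** * The homogeneous components of D^+ and the generating series *)

Local Notation refl k := (- 'X - (k%:~R + 1)%:P : {poly Cx}).

Lemma comp_affineA (f p q r : {poly Cx}) : p \Po q = r -> (f \Po p) \Po q = f \Po r.
Proof. by rewrite -comp_polyA => ->. Qed.

Lemma comp_polyN (p q : {poly Cx}) : (- p) \Po q = - (p \Po q).
Proof. exact: raddfN. Qed.

Lemma comp_poly1 (q : {poly Cx}) : 1 \Po q = 1.
Proof. exact: comp_polyC. Qed.

Definition comp_polyE := (comp_polyD, comp_polyB, comp_polyM, comp_polyX, comp_polyC,
  comp_polyN, comp_poly1).

Lemma reflK k (f : {poly Cx}) : (f \Po refl k) \Po refl k = f.
Proof. rewrite (comp_affineA f (r := 'X)) ?comp_polyXr // !comp_polyE; ring. Qed.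

(** The projection onto D^+_k along the polynomials invariant under [refl k]. Composing with it
    extends maps linear only on D^+_k to all polynomials. *)
Definition odd_part (k : int) (f : {poly Cx}) : {poly Cx} := 2^-1 *: (f - (f \Po refl k)).

Lemma odd_part_lin k (a : Cx) (f g : {poly Cx}) :
  odd_part k (a *: f + g) = a *: odd_part k f + odd_part k g.
Proof.
rewrite /odd_part comp_polyD comp_polyZ opprD addrACA -scalerBr scalerDr.
by rewrite !scalerA mulrC.
Qed.

Lemma Dplus_odd_part k f : Dplus k (odd_part k f).
Proof.
rewrite /Dplus /odd_part comp_polyZ comp_polyB reflK -scalerN opprB.
by [].
Qed.

Lemma odd_part_id k f : Dplus k f -> odd_part k f = f.
Proof.
rewrite /Dplus /odd_part => ->; rewrite opprK -mulr2n -[f *+ 2]scaler_nat scalerA.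
by rewrite mulVf ?scale1r // pnatr_eq0.
Qed.

Lemma odd_part_even k f : f \Po refl k = f -> odd_part k f = 0.
Proof. by rewrite /odd_part => ->; rewrite subrr scaler0. Qed.

Lemma comp_refl_even_part k f :
  (f - odd_part k f) \Po refl k = f - odd_part k f.
Proof.
have odd2 : odd_part k f + odd_part k f = f - (f \Po refl k).
  rewrite /odd_part -scalerDl; have -> : (2^-1 + 2^-1 : Cx) = 1 by field.
  exact: scale1r.
rewrite comp_polyB Dplus_odd_part opprK; apply/eqP.
by rewrite eq_sym subr_eq -addrA odd2 addrC subrK.
Qed.

Lemma Dplus_lin k (a : Cx) (f g : {poly Cx}) : Dplus k f -> Dplus k g -> Dplus k (a *: f + g).
Proof. by rewrite /Dplus comp_polyD comp_polyZ => -> ->; rewrite scalerN opprD. Qed.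

Lemma Dplus0 k : Dplus k 0.
Proof. by rewrite /Dplus comp_poly0 oppr0. Qed.

Lemma Dplus_even_mul k f h : Dplus k f -> h \Po refl k = h -> Dplus k (f * h).
Proof. by rewrite /Dplus comp_polyM => -> ->; rewrite mulNr. Qed.

Lemma Dplus_bracket r f s g :
  Dplus r f -> Dplus s g -> Dplus (r + s) (bracket_poly r f s g).
Proof.
rewrite /Dplus /bracket_poly => Df Dg; rewrite comp_polyB !comp_polyM.
rewrite (comp_affineA f (r := refl r)); last by rewrite !comp_polyE; ring.
rewrite (comp_affineA g (r := refl s)); last by rewrite !comp_polyE; ring.
rewrite -(comp_affineA f (p := refl r) (q := 'X + (s%:~R)%:P) (r := refl (r + s))); last first.
  by rewrite !comp_polyE; ring.
rewrite -(comp_affineA g (p := refl s) (q := 'X + (r%:~R)%:P) (r := refl (r + s))); last first.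
  by rewrite !comp_polyE; ring.
by rewrite Df Dg !comp_polyN; ring.
Qed.

Lemma Psi_deg_neq0 r f s g : r + s != 0 -> Psi r f s g = 0.
Proof. by rewrite /Psi => ->. Qed.

Lemma Psi_deg0l f s g : Psi 0 f s g = 0.
Proof. by rewrite /Psi; case: ifP => //= _; rewrite /psi0 big_ord0. Qed.

Lemma Psi_deg1 f g : Psi 1 f (-1) g = f.[-1] * g.[0].
Proof. by rewrite /Psi subrr /= /psi0 big_ord1. Qed.

Lemma Dplus_neg1E f : Dplus (-1) f = (f \Po - 'X = - f).
Proof. by rewrite /Dplus; congr (_ \Po _ = _); ring. Qed.

(** Together with [Dplus1_shiftP], this parametrises degree 1 by odd polynomials, just as degree
    -1. *)
Lemma Dplus_neg1_shift g : Dplus (-1) g -> Dplus 1 (g \Po ('X + 1)).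
Proof.
rewrite Dplus_neg1E /Dplus => g_odd.
rewrite -[in RHS](opprK g) -g_odd comp_polyN opprK.
by rewrite !(comp_affineA g (erefl _)); congr (_ \Po _); rewrite !comp_polyE; ring.
Qed.

Lemma Dplus1_shiftP f : Dplus 1 f ->
  exists2 g, Dplus (-1) g & f = g \Po ('X + 1).
Proof.
rewrite /Dplus => Df; exists (f \Po ('X - 1)); last first.
  by rewrite (comp_affineA f (r := 'X)) ?comp_polyXr // !comp_polyE; ring.
rewrite /Dplus -comp_polyN -Df !(comp_affineA f (erefl _)); congr (_ \Po _).
by rewrite !comp_polyE; ring.
Qed.

Lemma comp_shift_neq0 (a : Cx) f : f != 0 -> f \Po ('X + a%:P) != 0.
Proof. by rewrite -!size_poly_gt0 size_comp_poly2 // size_XaddC. Qed.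

(** The bracket depends only on the product [g * b], so one functional of that product governs the
    pairing of degrees 1 and -1. *)
Lemma bracket_deg1 g b :
  bracket_poly 1 (g \Po ('X + 1)) (-1) b = g * b - ((g * b) \Po ('X + 1)).
Proof.
rewrite /bracket_poly comp_polyM (comp_affineA g (r := 'X)); last by rewrite !comp_polyE; ring.
by rewrite comp_polyXr.
Qed.

(** * The weight as a functional on all polynomials, and its generating series *)

Section WeightFunctional.
Variable Lambda0 : {poly Cx} -> Cx.
Hypothesis Lambda0_lin : forall (a : Cx) (f g : {poly Cx}), Dplus 0 f -> Dplus 0 g ->
  Lambda0 (a *: f + g) = a * Lambda0 f + Lambda0 g.

(** [Lambda0] is linear on D^+_0 only; precomposing with the projection gives a functional linear on
    all polynomials. *)
Let LambdaT f := Lambda0 (odd_part 0 f).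

Let LambdaT_lin (a : Cx) (f g : {poly Cx}) : LambdaT (a *: f + g) = a * LambdaT f + LambdaT g.
Proof. by rewrite /LambdaT odd_part_lin Lambda0_lin //; apply: Dplus_odd_part. Qed.

Let Lambda00 : Lambda0 0 = 0.
Proof.
have /(_ (Dplus0 0) (Dplus0 0)) := @Lambda0_lin (-1) 0 0.
by rewrite scaler0 addr0 mulN1r addNr.
Qed.

(** The functional called phi in the opening overview. *)
Definition weight_diff h := LambdaT (h - (h \Po ('X + 1))).

Lemma weight_diff_lin (a : Cx) (g h : {poly Cx}) :
  weight_diff (a *: g + h) = a * weight_diff g + weight_diff h.
Proof.
rewrite /weight_diff -LambdaT_lin; congr LambdaT.
by rewrite comp_polyD comp_polyZ opprD addrACA -scalerBr.
Qed.

(** For odd [h], [refl 0] swaps [h] and minus its shift, so the difference is invariant and projects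
    to 0. This makes the quasipolynomial even. *)
Lemma weight_diff_odd h : h \Po - 'X = - h -> weight_diff h = 0.
Proof.
move=> h_odd; rewrite /weight_diff /LambdaT odd_part_even //.
rewrite comp_polyB (comp_affineA h (r := - 'X)); last by rewrite !comp_polyE; ring.
rewrite -(comp_affineA h (p := - 'X) (q := 'X + 1) (r := refl 0)); last by rewrite !comp_polyE; ring.
by rewrite h_odd comp_polyN opprK addrC.
Qed.

Lemma weight_diff1 : weight_diff 1 = 0.
Proof. by rewrite /weight_diff comp_polyC subrr /LambdaT odd_part_even ?comp_poly0. Qed.

(** [refl 0] negates X + 1/2, so even powers project to 0, in agreement with the zero even
    coefficients of the series. *)
Lemma DeltaSeriesE n :
  DeltaSeries Lambda0 n = - LambdaT (('X + (2^-1)%:P) ^+ n) / n`!%:R.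
Proof.
have half_refl : ('X + (2^-1)%:P) \Po refl 0 = - ('X + (2^-1)%:P) :> {poly Cx}.
  rewrite !comp_polyE; have -> : (0%:~R + 1 : Cx) = 2^-1 + 2^-1 by field.
  by rewrite polyCD; ring.
rewrite /DeltaSeries /DeltaP /LambdaT.
have half_reflX : (('X + (2^-1)%:P) ^+ n) \Po refl 0 =
    (-1) ^+ n * ('X + (2^-1)%:P) ^+ n :> {poly Cx}.
  by rewrite rmorphXn /= half_refl; apply: exprNn.
case: ifPn => odd_n.
  rewrite odd_part_id // /Dplus half_reflX -signr_odd odd_n expr1 mulN1r.
  by [].
rewrite odd_part_even ?Lambda00 ?oppr0 ?mul0r //.
by rewrite half_reflX -signr_odd (negPf odd_n) expr0 mul1r.
Qed.

Lemma sinh2_coefE n :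
  sinh2_coef n = ((2^-1) ^+ n - (- 2^-1) ^+ n) / n`!%:R.
Proof.
rewrite /sinh2_coef [(- _) ^+ n]exprNn -signr_odd.
by case: odd; [rewrite expr1; congr (_ / _); ring | rewrite expr0 mul1r subrr mul0r].
Qed.

(* [2 sinh(x/2)] times the generating series of [u^n] is that of
   [(u + 1/2)^n - (u - 1/2)^n]. *)
Lemma DeltaSeries_mul_sinh n :
  \sum_(i < n.+1) DeltaSeries Lambda0 i * sinh2_coef (n - i) =
  weight_diff 'X^n / n`!%:R.
Proof.
pose u : {poly Cx} := 'X + (2^-1)%:P.
have half2 : (2^-1 + 2^-1 : Cx) = 1 by field.
have -> : weight_diff 'X^n = LambdaT (\sum_(i < n.+1)
   (((- 2^-1) ^+ (n - i) - 2^-1 ^+ (n - i)) *+ 'C(n, i)) *: u ^+ i).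
  congr LambdaT; rewrite rmorphXn /= comp_polyX.
  have -> : 'X^n = ((- 2^-1)%:P + u) ^+ n by rewrite /u polyCN; congr (_ ^+ n); ring.
  have -> : 'X + 1 = (2^-1)%:P + u.
    by rewrite /u addrCA -polyCD half2.
  rewrite !exprDn -sumrB; apply: eq_bigr => i _.
  by rewrite -!polyC_exp -mulrnBl -mulrBl -polyCB mul_polyC scalerMnl.
rewrite (@lmorph_sum Cx {poly Cx} Cx^o LambdaT) // mulr_suml; apply: eq_bigr => i _.
rewrite DeltaSeriesE sinh2_coefE -/u.
have le_in : (i <= n)%N by rewrite -ltnS.
rewrite -(bin_fact le_in) !natrM -[_ *: _]/(_ * _).
have f1 : (i`!%:R != 0 :> Cx) by rewrite pnatr_eq0 -lt0n fact_gt0.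
have f2 : ((n - i)`!%:R != 0 :> Cx) by rewrite pnatr_eq0 -lt0n fact_gt0.
have f3 : ('C(n, i)%:R != 0 :> Cx) by rewrite pnatr_eq0 -lt0n bin_gt0.
rewrite -[(_ - _) *+ _]mulr_natr.
by field; rewrite f1 f2 f3.
Qed.

End WeightFunctional.

(** The k-th derivative of X^n carries the factor n!/(n-k)!, so division by n! gives the coefficient
    of x^n in x^k e^{bx}. *)
Lemma qp_coefE F n : qp_coef F n = qp_functional F 'X^n / n`!%:R.
Proof.
rewrite /qp_coef /qp_functional mulr_suml; apply: eq_bigr => -[b q] _ /=.
(* One sum stops at [size q], the other at [n]; both are widened to a common range, where the extra
   terms vanish. *)
transitivity (\sum_(k < size q + n.+1) q`_k * ('X^n)^`(k).[b] / n`!%:R); last first.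
  by rewrite -mulr_suml (qp_pair_widen _ _ (leq_addr n.+1 _)).
rewrite (big_ord_widen (size q + n.+1) (fun k => q`_k * b ^+ (n - k) / (n - k)`!%:R)) ?leq_addl //.
rewrite big_mkcond; apply: eq_bigr => k _; rewrite derivnXn hornerMn hornerXn.
case: ltnP => [|lt_nk]; last by rewrite ffact_small // mulr0n mulr0 mul0r.
rewrite ltnS => le_kn; rewrite -mulrA -[in RHS]mulrA; congr (_ * _).
rewrite -(ffact_fact le_kn) natrM -mulr_natr.
have f2 : ((n - k)`!%:R != 0 :> Cx) by rewrite pnatr_eq0 -lt0n fact_gt0.
have f3 : ((n ^_ k)%:R != 0 :> Cx) by rewrite pnatr_eq0 -lt0n ffact_gt0.
by field; rewrite f2 f3.
Qed.

(** The series identity says that [weight_diff] and [qp_functional F] agree on every X^n. Evenness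
    and F(0) = 0 hold because [weight_diff] vanishes on odd polynomials and on 1. *)
Lemma weight_diff_qpP Lambda0 :
  (forall (a : Cx) (f g : {poly Cx}), Dplus 0 f -> Dplus 0 g ->
     Lambda0 (a *: f + g) = a * Lambda0 f + Lambda0 g) ->
  (exists2 p : {poly Cx}, p != 0 & forall h, weight_diff Lambda0 (p * h) = 0) <->
  exists F : seq (Cx * {poly Cx}),
     [/\ (forall n, odd n -> qp_coef F n = 0),
         qp_coef F 0 = 0
       & (forall n, \sum_(i < n.+1) DeltaSeries Lambda0 i * sinh2_coef (n - i)
                    = qp_coef F n)].
Proof.
move=> Lambda0_lin; pose lin := weight_diff_lin Lambda0_lin.
split=> [[p p0 p_ann]|[F [_ _ defF]]].
  have [F defF] := annihilated_qp lin p0 p_ann.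
  exists F; split=> [n odd_n||n]; rewrite qp_coefE -defF.
  - rewrite (weight_diff_odd Lambda0_lin) ?mul0r // rmorphXn /= comp_polyX.
    by rewrite exprNn -signr_odd odd_n expr1 mulN1r.
  - by rewrite expr0 (weight_diff1 Lambda0_lin) mul0r.
  - exact: DeltaSeries_mul_sinh.
have [p p0 p_ann] := qp_functional_annihilator F.
exists p => // h; rewrite -(p_ann h); apply: poly_functional_ext => // [a f g|n].
  rewrite /qp_functional mulr_sumr -big_split; apply: eq_bigr => q _.
  exact: qp_pair_linr.
have := defF n; rewrite (DeltaSeries_mul_sinh Lambda0_lin) qp_coefE.
by apply: mulIf; rewrite invr_eq0 pnatr_eq0 -lt0n fact_gt0.
Qed.

(** * Modules over D^+ *)

(** The coordinate matrix has one more row than columns, so its left kernel is nonzero. *)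
Lemma linear_dependence (K : fieldType) (V : lmodType K) (B : seq V) (x : nat -> V) :
  (forall i, exists c : nat -> K, x i = \sum_(j < size B) c j *: B`_j) ->
  exists2 u : nat -> K, (exists2 i, (i <= size B)%N & u i != 0) &
    \sum_(i < (size B).+1) u i *: x i = 0.
Proof.
move=> x_span; pose n := size B.
have [c def_x] := fin_all_exists (fun i : 'I_n.+1 => x_span i).
pose M := \matrix_(i < n.+1, j < n) c i j.
have : kermx M != 0.
  rewrite kermx_eq0 /row_free; apply/eqP => rkM.
  by have := rank_leq_col M; rewrite rkM ltnn.
case/rowV0Pn => u /sub_kermxP uM0 u0.
have [i ui0] : exists i, u 0 i != 0.
  by case/rV0Pn: u0 => i; exists i.
exists (fun i => u 0 (inord i)).
  by exists i; [rewrite -ltnS | rewrite inord_val].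
transitivity (\sum_(j < n) (u *m M) 0 j *: B`_j); last first.
  by rewrite uM0 big1 // => j _; rewrite mxE scale0r.
under eq_bigr => i0 _ do rewrite def_x inord_val scaler_sumr.
rewrite exchange_big; apply: eq_bigr => j _ /=; rewrite mxE scaler_suml.
by apply: eq_bigr => i0 _; rewrite scalerA mxE.
Qed.

(** * Spans and eigenvectors *)

Section Span.
Variable V : lmodType Cx.
Implicit Types (S T : V -> Prop) (x y : V) (B : seq V).

Lemma in_span0 S : in_span S 0.
Proof. by exists [::]; rewrite big_nil; split. Qed.

Lemma in_span_gen S x : S x -> in_span S x.
Proof.
move=> Sx; exists [:: (1, x)]; rewrite big_seq1 scale1r; split=> //.
by constructor.
Qed.

Lemma in_span_lin S (a : Cx) x y : in_span S x -> in_span S y -> in_span S (a *: x + y).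
Proof.
move=> [l [Sl ->]] [m [Sm ->]]; exists ([seq (a * p.1, p.2) | p <- l] ++ m); split.
  apply/List.Forall_app; split=> //.
  by elim: Sl => [|p l' Sp _ IHl] /=; constructor.
rewrite big_cat big_map scaler_sumr; congr (_ + _).
by apply: eq_bigr => p _; rewrite scalerA.
Qed.

Lemma in_span_add S x y : in_span S x -> in_span S y -> in_span S (x + y).
Proof. by rewrite -[x in _ -> _ -> in_span _ (x + _)]scale1r; apply: in_span_lin. Qed.

Lemma in_span_scale S (a : Cx) x : in_span S x -> in_span S (a *: x).
Proof. by move=> Sx; rewrite -[_ *: _]addr0; apply: in_span_lin => //; apply: in_span0. Qed.

Lemma in_span_ind S (P : V -> Prop) : P 0 ->
  (forall (a : Cx) x y, P x -> P y -> P (a *: x + y)) ->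
  (forall x, S x -> P x) -> forall x, in_span S x -> P x.
Proof.
move=> P0 Plin PS _ [l [Sl ->]].
elim: Sl => [|p l' Sp _ IHl]; first by rewrite big_nil.
by rewrite big_cons; apply: Plin => //; apply: PS.
Qed.

Lemma in_span_map (f : V -> V) S T x :
  (forall (a : Cx) x y, f (a *: x + y) = a *: f x + f y) ->
  (forall y, S y -> in_span T (f y)) -> in_span S x -> in_span T (f x).
Proof.
move=> f_lin fST; elim/in_span_ind => [|a y z IHy IHz|]; last exact: fST.
  by rewrite lmorph0 //; apply: in_span0.
by rewrite f_lin; apply: in_span_lin.
Qed.

Lemma in_span_sub S T x : (forall y, S y -> in_span T y) -> in_span S x -> in_span T x.
Proof. exact: (@in_span_map id). Qed.

Lemma in_span_seq_coord B x : in_span (fun y => y \in B) x ->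
  exists c : nat -> Cx, x = \sum_(j < size B) c j *: B`_j.
Proof.
elim/in_span_ind => [|a y z [c ->] [d ->]|y By].
- by exists (fun=> 0); rewrite big1 // => j _; rewrite scale0r.
- exists (fun j => a * c j + d j); rewrite scaler_sumr -big_split.
  by apply: eq_bigr => j _; rewrite scalerDl scalerA.
exists (fun j => if j == index y B then 1 else 0).
have lt_yB : (index y B < size B)%N by rewrite index_mem.
rewrite (bigD1 (Ordinal lt_yB)) //= eqxx scale1r nth_index // big1 ?addr0 // => j.
by rewrite -val_eqE /= => /negPf ->; rewrite scale0r.
Qed.

Lemma in_span_catl B1 B2 x :
  in_span (fun y => y \in B1) x -> in_span (fun y => y \in B1 ++ B2) x.
Proof. by apply: in_span_sub => y By; apply: in_span_gen; rewrite mem_cat By. Qed.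

Lemma in_span_catr B1 B2 x :
  in_span (fun y => y \in B2) x -> in_span (fun y => y \in B1 ++ B2) x.
Proof. by apply: in_span_sub => y By; apply: in_span_gen; rewrite mem_cat By orbT. Qed.

Lemma finite_span_cover (I : eqType) (s : seq I) (Q : I -> V -> Prop) :
  (forall i, i \in s -> exists B, forall x, Q i x -> in_span (fun y => y \in B) x) ->
  exists B, forall i x, i \in s -> Q i x -> in_span (fun y => y \in B) x.
Proof.
elim: s => [|i s IHs] Qs; first by exists [::].
have [B1 Q1] := Qs i (mem_head i s).
have [|B2 Q2] := IHs; first by move=> j sj; apply: Qs; rewrite inE sj orbT.
exists (B1 ++ B2) => j x; rewrite inE => /orP[/eqP-> Qx|sj Qx].
  exact/in_span_catl/Q1.
exact/in_span_catr/(Q2 j).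
Qed.

(** Applying d - mu to a relation deletes a term of eigenvalue mu, keeps the other terms
    eigenvectors and multiplies [v] by the nonzero lam - mu. *)
Lemma eigenvector_notin_span (d : V -> V) (lam : Cx) v :
  (forall (a : Cx) x y, d (a *: x + y) = a *: d x + d y) ->
  d v = lam *: v ->
  in_span (fun y => exists2 mu : Cx, mu != lam & d y = mu *: y) v -> v = 0.
Proof.
move=> d_lin dv [l [l_eig]]; rewrite -[v in v = \sum_(_ <- _) _]scale1r => def_v.
have dZ a x : d (a *: x) = a *: d x.
  have d0 : d 0 = 0 := lmorph0 d_lin.
  by rewrite -[a *: x]addr0 d_lin d0 addr0.
apply/eqP; apply/idPn => v0.
suff /eqP: (1 : Cx) = 0 by rewrite oner_eq0.
move: {2}(size l) (erefl (size l)) => n sz_l.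
(* The coefficient 1 of [v] is generalised to [b], since each deletion multiplies it by lam - mu. *)
elim: n l sz_l l_eig 1 def_v => [|n IHn] [|[a y] l] //= sz_l l_eig b def_v.
  by apply/eqP; move/eqP: def_v; rewrite big_nil scaler_eq0 (negPf v0) orbF.
case/List.Forall_cons_iff: l_eig => -[mu mu_lam dy] l_eig.
suff /eqP: b * (lam - mu) = 0.
  by rewrite mulf_eq0 subr_eq0 [lam == mu]eq_sym (negPf mu_lam) orbF => /eqP.
apply: (IHn [seq (p.1, d p.2 - mu *: p.2) | p <- l]); first by rewrite size_map; case: sz_l.
  elim: l_eig => [|p l' [nu nu_lam dp] _ IHl] /=; constructor=> //.
  exists nu => //=; rewrite addrC -scaleNr d_lin dp dZ dp !scaleNr.
  by rewrite scalerDr scalerN !scalerA mulrC.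
transitivity (d (b *: v) - mu *: (b *: v)).
  by rewrite dZ dv !scalerA -scalerBl mulrBr [mu * b]mulrC.
rewrite def_v big_cons d_lin dy scalerDr opprD addrACA !scalerA mulrC subrr add0r.
rewrite (lmorph_sum (f := d)) // scaler_sumr -sumrB big_map; apply: eq_bigr => p _ /=.
by rewrite scalerBr !scalerA mulrC.
Qed.

End Span.

Definition neg_word (w : seq (int * {poly Cx})) : Prop :=
  List.Forall (fun p => Dplus p.1 p.2 /\ p.1 < 0) w.

Lemma wdeg_cons p w : wdeg (p :: w) = p.1 + wdeg w.
Proof. exact: big_cons. Qed.

Lemma wdeg_nil : wdeg [::] = 0.
Proof. exact: big_nil. Qed.

Lemma neg_word_wdeg w : neg_word w -> wdeg w <= 0 ?= iff (w == [::]).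
Proof.
elim: w => [|p w IHw]; first by rewrite wdeg_nil; split; rewrite ?eqxx.
case/List.Forall_cons_iff => -[_ p_lt0] /IHw[le_w _].
rewrite wdeg_cons; split; first lia.
by apply/negbTE; lia.
Qed.

(** * The energy operator, triangular decomposition and local finiteness *)

Section Module.
Variables (V : lmodType Cx) (rho : int -> {poly Cx} -> V -> V) (rhoC : V -> V).
Hypothesis rho_mod : is_DhatPlus_module rho rhoC.
Implicit Types (x y : V) (f g : {poly Cx}).

Lemma rho_lin k f : Dplus k f ->
  forall (a : Cx) x y, rho k f (a *: x + y) = a *: rho k f x + rho k f y.
Proof. by case: rho_mod => rl _ _ _ _; apply: rl. Qed.

Lemma rho_linl k f g (a : Cx) x : Dplus k f -> Dplus k g ->
  rho k (a *: f + g) x = a *: rho k f x + rho k g x.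
Proof. by case: rho_mod => _ _ rl _ _; apply: rl. Qed.

Lemma rho_0r k f : Dplus k f -> rho k f 0 = 0.
Proof.
by move=> Df; apply/lmorph0/rho_lin.
Qed.

Lemma rho_Z k f (a : Cx) x : Dplus k f -> rho k f (a *: x) = a *: rho k f x.
Proof. by move=> Df; rewrite -[a *: x]addr0 rho_lin // rho_0r // addr0. Qed.

Lemma rho_comm r f s g x : Dplus r f -> Dplus s g ->
  rho r f (rho s g x) = rho s g (rho r f x) +
    (rho (r + s) (bracket_poly r f s g) x + Psi r f s g *: rhoC x).
Proof.
move=> Df Dg; case: rho_mod => _ _ _ _ rc.
by rewrite -rc // addrC subrK.
Qed.

Lemma rho_0l k x : rho k 0 x = 0.
Proof.
have := rho_linl (-1) x (Dplus0 k) (Dplus0 k).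
by rewrite scaler0 addr0 scaleN1r addNr.
Qed.

Lemma rho_odd_part_lin k x (a : Cx) f g :
  rho k (odd_part k (a *: f + g)) x =
  a *: rho k (odd_part k f) x + rho k (odd_part k g) x.
Proof. by rewrite odd_part_lin rho_linl //; apply: Dplus_odd_part. Qed.

(** The action of D + 1/2. Its bracket with D^+_k is multiplication by k, so its eigenvalues detect
    degrees; D itself does not lie in D^+. *)
Definition energy : V -> V := rho 0 ('X + (2^-1)%:P).

Lemma Dplus_energy : Dplus 0 ('X + (2^-1)%:P).
Proof.
rewrite /Dplus !comp_polyE; have -> : (0%:~R + 1 : Cx) = 2^-1 + 2^-1 by field.
by rewrite polyCD; ring.
Qed.

Lemma energy_rho k f x : Dplus k f ->
  energy (rho k f x) = rho k f (energy x) + k%:~R *: rho k f x.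
Proof.
move=> Df; rewrite /energy (rho_comm _ Dplus_energy Df) Psi_deg0l scale0r addr0 add0r.
congr (_ + _); suff -> : bracket_poly 0 ('X + (2^-1)%:P) k f = k%:~R *: f + 0.
  by rewrite rho_linl ?rho_0l ?addr0 //; apply: Dplus0.
rewrite /bracket_poly polyC0 addr0 comp_polyXr !comp_polyE -mul_polyC; ring.
Qed.

Lemma energy_act mu w x : is_word w -> energy x = mu *: x ->
  energy (act rho w x) = (mu + (wdeg w)%:~R) *: act rho w x.
Proof.
move=> Ww ex; elim: Ww => [|p w' Dp _ IHw]; first by rewrite wdeg_nil addr0.
rewrite [act _ _ _]/= energy_rho // IHw rho_Z // -scalerDl wdeg_cons rmorphD /=.
by congr (_ *: _); ring.
Qed.

Lemma neg_word_word w : neg_word w -> is_word w.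
Proof. by apply: List.Forall_impl => p []. Qed.

(** The degree [j] part of U(D^+_-) S, with [S] placed in degree 0. *)
Definition lower_span (S : V -> Prop) (j : int) : V -> Prop :=
  in_span (fun y => exists w s, [/\ neg_word w, wdeg w = j, S s & y = act rho w s]).

Lemma lower_span_neg S k f j x : Dplus k f -> k < 0 ->
  lower_span S j x -> lower_span S (k + j) (rho k f x).
Proof.
move=> Df k0; apply: in_span_map; first exact: rho_lin.
move=> _ [w [s [Nw <- Ss ->]]]; apply: in_span_gen; exists ((k, f) :: w), s.
by split=> //; [constructor | rewrite wdeg_cons].
Qed.

Variable c : Cx.
Hypothesis rhoC_scalar : forall x, rhoC x = c *: x.

(* Triangular decomposition: nonnegative generators can be commuted past the
   negative ones. *)
Lemma lower_span_rho S k f j x :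
  (forall k f s, 0 < k -> Dplus k f -> S s -> rho k f s = 0) ->
  (forall f s, Dplus 0 f -> S s -> S (rho 0 f s)) ->
  Dplus k f -> lower_span S j x -> lower_span S (k + j) (rho k f x).
Proof.
move=> S_pos S_0 Df; apply: in_span_map; first exact: rho_lin.
move=> _ [w [s [Nw <- Ss ->]]] {j x}.
suff: lower_span S (k + wdeg w) (rho k f (act rho w s)) by [].
have act_lower u : neg_word u -> lower_span S (wdeg u) (act rho u s).
  by move=> Nu; apply: in_span_gen; exists u, s.
elim: w Nw k f Df => [|[r g] w IHw] Nw k f Df.
  rewrite wdeg_nil addr0 /=; case: (ltgtP k 0) => [k0|k0|k0].
  - have := @lower_span_neg S k f 0 s Df k0; rewrite addr0; apply.
    by rewrite -wdeg_nil; apply: (act_lower [::]); constructor.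
  - by rewrite S_pos //; apply: in_span0.
  subst k; apply: in_span_gen; exists [::], (rho 0 f s).
  by split; [constructor | apply: wdeg_nil | apply: S_0 |].
have [k0|k0] := ltP k 0; first by apply: lower_span_neg => //; apply: act_lower.
case/List.Forall_cons_iff: Nw => -[/= Dg r0] Nw.
rewrite wdeg_cons /= rho_comm //; apply: in_span_add.
  by rewrite addrCA; apply: lower_span_neg => //; apply: IHw.
(* The bracket acts on a shorter word, so the induction hypothesis covers it whatever the sign of
   [k + r]. *)
apply: in_span_add; first by rewrite addrA; apply: IHw => //; apply: Dplus_bracket.
have [kr0|kr0] := eqVneq (k + r) 0.
  by rewrite rhoC_scalar addrA kr0 add0r; do 2!apply: in_span_scale; apply: act_lower.
by rewrite Psi_deg_neq0 // scale0r; apply: in_span0.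
Qed.

(** A real restriction even for one [k], since D^+_k is infinite dimensional. *)
Definition locally_finite x := forall k, exists B : seq V, forall f, Dplus k f ->
  in_span (fun y => y \in B) (rho k f x).

Lemma locally_finite0 : locally_finite 0.
Proof. by move=> k; exists [::] => f Df; rewrite rho_0r //; apply: in_span0. Qed.

Lemma locally_finite_lin (a : Cx) x y :
  locally_finite x -> locally_finite y -> locally_finite (a *: x + y).
Proof.
move=> fx fy k; have [[B1 h1] [B2 h2]] := (fx k, fy k).
exists (B1 ++ B2) => f Df; rewrite rho_lin //.
by apply: in_span_lin; [apply/in_span_catl/h1 | apply/in_span_catr/h2].
Qed.

(** In f g x = g f x + [f,g] x + central term, the three parts lie in the image under g of D^+_k x,
    in D^+_{k+s} x and in the line of C x. *)
Lemma locally_finite_rho s g x : Dplus s g -> locally_finite x ->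
  locally_finite (rho s g x).
Proof.
move=> Dg fx k; have [[B1 h1] [B2 h2]] := (fx k, fx (k + s)).
exists (map (rho s g) B1 ++ (B2 ++ [:: rhoC x])) => f Df.
rewrite rho_comm //; apply: in_span_add.
  apply: in_span_catl; apply: in_span_map (h1 f Df); first exact: rho_lin.
  by move=> y By; apply: in_span_gen; apply: map_f.
apply/in_span_catr/in_span_add; first exact/in_span_catl/h2/Dplus_bracket.
by apply/in_span_catr/in_span_scale/in_span_gen; rewrite inE.
Qed.

(** Induction on -j: without its first letter, a negative word gives a vector of a
    finite-dimensional space of degree nearer 0, and local finiteness of the spanning vectors bounds
    the action of that letter. *)
Lemma lower_span_finite v j : (forall x, locally_finite x) ->
  exists B : seq V, forall x, lower_span (fun s => exists a : Cx, s = a *: v) j x ->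
    in_span (fun y => y \in B) x.
Proof.
move=> lf; set S := (fun s : V => exists a : Cx, s = a *: v).
have [j0|j0] := ltP 0 j.
  exists [::] => x; apply: in_span_sub => y [w [s [Nw def_j _ _]]].
  by have [] := neg_word_wdeg Nw; rewrite def_j leNgt j0.
have [n ->] : exists n : nat, j = - n%:Z by exists `|j|%N; lia.
elim/ltn_ind: n {j j0} => n IHn.
case: n IHn => [|n] IHn.
  exists [:: v] => x; apply: in_span_sub => _ [w [s [Nw def_j [a ->] ->]]].
  have [_] := neg_word_wdeg Nw; rewrite def_j oppr0 eqxx => /esym/eqP -> /=.
  by apply/in_span_scale/in_span_gen; rewrite inE.
(* In total degree -(n+1), a first letter of degree -(m+1) leaves degree -(n-m), with m from 0 to
   n. *)
pose Q m x := exists g y,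
  [/\ Dplus (- m.+1%:Z) g, lower_span S (- (n - m)%N%:Z) y & x = rho (- m.+1%:Z) g y].
have [|B defB] := @finite_span_cover V nat (iota 0 n.+1) Q.
  move=> m _; have [|B1 h1] := IHn (n - m)%N; first lia.
  have [|B2 h2] := @finite_span_cover V V B1
     (fun b x => exists2 g, Dplus (- m.+1%:Z) g & x = rho (- m.+1%:Z) g b).
    by move=> b _; have [B hB] := lf b (- m.+1%:Z); exists B => _ [g Dg ->]; apply: hB.
  exists B2 => _ [g [y [Dg low_y ->]]]; apply: in_span_map (h1 y low_y); first exact: rho_lin.
  by move=> b B1b; apply: h2 B1b _; exists g.
exists B => x; apply: in_span_sub => _ [w [s [Nw def_j Ss ->]]].
case: w Nw def_j => [|[r g] w] Nw; first by rewrite wdeg_nil; lia.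
case/List.Forall_cons_iff: Nw => -[/= Dg r0] Nw; rewrite wdeg_cons /= => def_j.
have [w0 _] := neg_word_wdeg Nw.
pose m := `|r|.-1.
have def_r : r = - m.+1%:Z by rewrite /m; lia.
apply: (defB m); first by rewrite mem_iota /m; lia.
exists g, (act rho w s); rewrite -def_r; split=> //.
by apply: in_span_gen; exists w, s; split=> //; rewrite /m; lia.
Qed.

End Module.

(** * Highest weight modules *)

Section HighestWeight.
Variables (Lambda0 : {poly Cx} -> Cx) (c : Cx).
Variables (V : lmodType Cx) (rho : int -> {poly Cx} -> V -> V) (rhoC : V -> V) (v : V).
Hypothesis rho_mod : is_DhatPlus_module rho rhoC.
Hypothesis v_hw : is_highest_weight_module rho rhoC Lambda0 c v.
Implicit Types (x y : V) (f g h : {poly Cx}).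

Lemma hw_neq0 : v != 0. Proof. by case: v_hw. Qed.

Lemma hw_pos k f : 0 < k -> Dplus k f -> rho k f v = 0.
Proof. by case: v_hw => _ hp _ _ _; apply: hp. Qed.

Lemma hw_weight f : Dplus 0 f -> rho 0 f v = Lambda0 f *: v.
Proof. by case: v_hw => _ _ hw _ _; apply: hw. Qed.

Lemma hw_ind (P : V -> Prop) : P 0 ->
  (forall (a : Cx) x y, P x -> P y -> P (a *: x + y)) -> P v ->
  (forall k f x, Dplus k f -> P x -> P (rho k f x)) -> forall x, P x.
Proof.
move=> P0 Plin Pv Prho x; case: v_hw => _ _ _ _ /(_ x).
apply: in_span_ind x => // _ [w [Ww ->]].
by elim: Ww => //= p w' Dp _; apply: Prho.
Qed.

Lemma rhoC_central x : rhoC x = c *: x.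
Proof.
case: rho_mod => _ C_lin _ C_comm _.
elim/hw_ind: x => [|a x y IHx IHy||k f x Df IHx].
- by rewrite scaler0; apply: lmorph0.
- by rewrite C_lin IHx IHy scalerDr !scalerA mulrC.
- by case: v_hw.
by rewrite C_comm // IHx (rho_Z rho_mod).
Qed.

Lemma energy_hw : energy rho v = Lambda0 ('X + (2^-1)%:P) *: v.
Proof. exact: hw_weight Dplus_energy. Qed.

(** Negative words on singular vectors of this energy have energies lam - 1, lam - 2, and so on. If
    [x] were nonzero they would span the module, and [v], of energy lam, would be a combination of
    eigenvectors with other eigenvalues. *)
Lemma degree_neg1_singular_eq0 x : irreducible_module rho rhoC ->
  (forall k f, 0 < k -> Dplus k f -> rho k f x = 0) ->
  energy rho x = (Lambda0 ('X + (2^-1)%:P) - 1) *: x -> x = 0.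
Proof.
move=> [_ irr] x_pos x_en; apply/eqP; apply/idPn => x0.
have := energy_hw; set lam := Lambda0 _ in x_en * => energy_v.
(* All singular vectors of this energy are taken, not just the line of [x]: the set has to be stable
   under D^+_0, which need not act on [x] by scalars. *)
pose S y := (forall k f, 0 < k -> Dplus k f -> rho k f y = 0) /\
  energy rho y = (lam - 1) *: y.
have S_pos k f s : 0 < k -> Dplus k f -> S s -> rho k f s = 0.
  by move=> k0 Df [s_pos _]; apply: s_pos.
have S_0 f s : Dplus 0 f -> S s -> S (rho 0 f s).
  move=> Df [s_pos s_en]; split=> [k g k0 Dg|].
    have := Dplus_bracket Dg Df; rewrite (rho_comm rho_mod) // s_pos // (rho_0r rho_mod) //.
    rewrite addr0 add0r => D; rewrite s_pos // add0r.
    by rewrite Psi_deg_neq0 ?scale0r // addr0 gt_eqF.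
  by rewrite (energy_rho rho_mod) // s_en (rho_Z rho_mod) // mulr0z scale0r addr0.
pose W := in_span (fun y => exists w s, [/\ neg_word w, S s & y = act rho w s]).
have W_v : W v.
  apply: irr; last first.
    exists x; split=> //; apply: in_span_gen; exists [::], x.
    by split=> //; constructor.
  split=> [|a y z|k f y Df|y Wy]; first exact: in_span0.
  - exact: in_span_lin.
  - apply: in_span_map; first exact: (rho_lin rho_mod).
    move=> _ [w [s [Nw Ss ->]]].
    have : lower_span rho S (wdeg w) (act rho w s).
      by apply: in_span_gen; exists w, s.
    move/(lower_span_rho rho_mod rhoC_central S_pos S_0 Df).
    by apply: in_span_sub => _ [u [t [Nu _ St ->]]]; apply: in_span_gen; exists u, t.
  by rewrite rhoC_central; apply: in_span_scale.
move/eqP: hw_neq0; apply; apply: (eigenvector_notin_span (d := energy rho) _ energy_v).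
  exact: (rho_lin rho_mod Dplus_energy).
apply: in_span_sub W_v => _ [w [s [Nw [_ s_en] ->]]]; apply: in_span_gen.
exists (lam - 1 + (wdeg w)%:~R).
  have [w0 _] := neg_word_wdeg Nw.
  rewrite -addrA -subr_eq0 addrAC subrr add0r addrC -[1]/(1%:~R) -rmorphB intr_eq0.
  lia.
exact: (energy_act rho_mod (neg_word_word Nw) s_en).
Qed.

(** * Annihilators of the highest weight vector *)

Hypothesis Lambda0_lin : forall (a : Cx) f g, Dplus 0 f -> Dplus 0 g ->
  Lambda0 (a *: f + g) = a * Lambda0 f + Lambda0 g.

(** Positive degree kills [v], so only the commutator survives; its central term has the factor
    b(0), which is 0 for odd [b]. *)
Lemma rho1_rho_neg1 g b : Dplus (-1) g -> Dplus (-1) b ->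
  rho 1 (g \Po ('X + 1)) (rho (-1) b v) = weight_diff Lambda0 (g * b) *: v.
Proof.
move=> Dg Db.
have D1 := Dplus_neg1_shift Dg.
rewrite (rho_comm rho_mod) // hw_pos // (rho_0r rho_mod) // add0r Psi_deg1.
have -> : b.[0] = 0.
  have /(congr1 (fun p => p.[0])) : b \Po - 'X = - b by rewrite -Dplus_neg1E.
  rewrite horner_comp !hornerE oppr0 => /eqP.
  by rewrite -addr_eq0 -mulr2n mulrn_eq0 => /eqP.
have := Dplus_bracket D1 Db; rewrite mulr0 scale0r addr0 subrr => D0.
by rewrite hw_weight // /weight_diff -bracket_deg1 odd_part_id.
Qed.

(* Odd [g] is covered by the action, and [g * b] is odd for even [g]. *)
Lemma weight_diff_annihilator b : Dplus (-1) b ->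
  (forall g, Dplus (-1) g -> weight_diff Lambda0 (g * b) = 0) ->
  forall h, weight_diff Lambda0 (b * h) = 0.
Proof.
move=> Db b_ann h; have := comp_refl_even_part (-1) h.
set e := h - _ => e_even.
have -> : b * h = 1 *: (odd_part (-1) h * b) + b * e by rewrite scale1r /e; ring.
rewrite weight_diff_lin // b_ann ?mulr0 ?add0r; last exact: Dplus_odd_part.
by rewrite weight_diff_odd // -Dplus_neg1E; apply: Dplus_even_mul.
Qed.

Lemma hw_annihilator_weight_diff b : Dplus (-1) b -> rho (-1) b v = 0 ->
  forall h, weight_diff Lambda0 (b * h) = 0.
Proof.
move=> Db bv0; apply: weight_diff_annihilator => // g Dg.
have /eqP := rho1_rho_neg1 Dg Db; rewrite bv0 (rho_0r rho_mod).
  by rewrite eq_sym scaler_eq0 (negPf hw_neq0) orbF => /eqP.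
exact: Dplus_neg1_shift.
Qed.

(** The vector is singular: degree 1 yields values of phi on multiples of [b], and degree k > 1
    yields an element of degree k - 1 > 0 applied to [v]. *)
Lemma weight_diff_hw_annihilator b : irreducible_module rho rhoC -> Dplus (-1) b ->
  (forall h, weight_diff Lambda0 (b * h) = 0) -> rho (-1) b v = 0.
Proof.
move=> irr Db b_ann; apply: degree_neg1_singular_eq0 => // [k f k0 Df|]; last first.
  rewrite (energy_rho rho_mod) // energy_hw (rho_Z rho_mod) // -scalerDl.
  by congr (_ *: _); rewrite rmorphN.
have [def_k|k1] := eqVneq k 1.
  subst k; have [g Dg ->] := Dplus1_shiftP Df.
  by rewrite rho1_rho_neg1 // mulrC b_ann scale0r.
rewrite (rho_comm rho_mod) // hw_pos // (rho_0r rho_mod) // add0r.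
rewrite hw_pos ?add0r; [|lia|exact: Dplus_bracket].
by rewrite Psi_deg_neq0 ?scale0r //; lia.
Qed.

(* Commuting with degree 0 multiplies [f] by finite differences, which exhaust
   the polynomials invariant under the reflection. *)
Lemma hw_annihilator_mul_even k f h : k != 0 -> Dplus k f -> rho k f v = 0 ->
  h \Po refl k = h -> rho k (f * h) v = 0.
Proof.
move=> k0 Df fv0 h_even.
have [g def_h] := @shift_diff_surj Cx k%:~R h (etrans (congr1 negb (intr_eq0 _ k)) k0).
(* Projecting [g] to D^+_0 keeps its difference equal to [h], because [h] is invariant. *)
have [g' Dg' {}def_h] : exists2 g', Dplus 0 g' & (g' \Po ('X + (k%:~R)%:P)) - g' = h.
  exists (odd_part 0 g); first exact: Dplus_odd_part.
  rewrite /odd_part comp_polyZ comp_polyB -scalerBr.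
  rewrite (comp_affineA g (r := refl k)); last by rewrite !comp_polyE; ring.
  have -> : g \Po refl 0 = (g \Po ('X + (k%:~R)%:P)) \Po refl k.
    by rewrite (comp_affineA g (r := refl 0)) // !comp_polyE; ring.
  have -> : g \Po ('X + (k%:~R)%:P) = h + g by rewrite -def_h subrK.
  rewrite comp_polyD h_even.
  have -> : h + g - (g \Po refl k) - (g - (h + (g \Po refl k))) = h + h by ring.
  rewrite scalerDr -scalerDl; have -> : (2^-1 + 2^-1 : Cx) = 1 by field.
  exact: scale1r.
have := rho_comm rho_mod v Df Dg'; rewrite hw_weight // (rho_Z rho_mod) // fv0.
rewrite scaler0 (rho_0r rho_mod) // add0r addr0 Psi_deg_neq0 ?addr0 // scale0r addr0.
have -> : bracket_poly k f 0 g' = (-1) *: (f * h) + 0.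
  by rewrite /bracket_poly -def_h polyC0 !addr0 comp_polyXr scaleN1r; ring.
rewrite (rho_linl rho_mod) ?(rho_0l rho_mod) ?addr0 ?scaleN1r.
- by move/eqP; rewrite eq_sym oppr_eq0 => /eqP.
- exact: Dplus_even_mul.
- exact: Dplus0.
Qed.

(** The bracket of two elements killing [v] kills [v]. If the bracket of [b] and [f] is zero,
    multiplying [f] by a suitable invariant factor makes it nonzero. *)
Lemma hw_annihilator_step k f b : k < 0 ->
  Dplus (-1) b -> b != 0 -> rho (-1) b v = 0 ->
  Dplus k f -> f != 0 -> rho k f v = 0 ->
  exists g, [/\ Dplus (-1 + k) g, g != 0 & rho (-1 + k) g v = 0].
Proof.
move=> k0 Db b0 bv0 Df f0 fv0.
have br h : h \Po refl k = h -> Dplus (-1 + k) (bracket_poly (-1) b k (f * h)) /\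
    rho (-1 + k) (bracket_poly (-1) b k (f * h)) v = 0.
  move=> h_even; have Dfh := Dplus_even_mul Df h_even.
  split; first exact: Dplus_bracket.
  have k_neq0 : k != 0 by lia.
  have := rho_comm rho_mod v Db Dfh.
  rewrite (hw_annihilator_mul_even k_neq0 Df fv0 h_even) bv0 !(rho_0r rho_mod) // add0r.
  by rewrite Psi_deg_neq0 ?scale0r ?addr0 //; lia.
have [D1 v1] := br 1 (comp_poly1 _).
have [br0|br0] := eqVneq (bracket_poly (-1) b k (f * 1)) 0; last first.
  by exists (bracket_poly (-1) b k (f * 1)).
(* [refl k] negates [z], so [z ^+ 2] is invariant. *)
pose z : {poly Cx} := 'X + 'X + (k%:~R + 1)%:P.
have [|D2 v2] := br (z ^+ 2).
  by rewrite rmorphXn /= /z !comp_polyE; ring.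
exists (bracket_poly (-1) b k (f * z ^+ 2)); split=> //.
(* [br0] equates the two products of the first bracket; shifting by -1 turns z into z - 2, and z^2 -
   (z - 2)^2 = 4(z - 1). *)
have -> : bracket_poly (-1) b k (f * z ^+ 2) =
    (b \Po ('X + (k%:~R)%:P)) * f * (4%:R * (z - 1)).
  have /eqP := br0; rewrite /bracket_poly mulr1 subr_eq0 => /eqP br0'.
  rewrite comp_polyM [_ * (f * _)]mulrA [b * (_ * _)]mulrA -br0' -mulrBr.
  congr (_ * _); rewrite rmorphXn /= /z !comp_polyE; ring.
rewrite !mulf_neq0 ?comp_shift_neq0 //.
  by rewrite -polyC_natr polyC_eq0 pnatr_eq0.
apply/eqP => /(congr1 (fun p : {poly Cx} => p`_1)).
rewrite /z !coefE /= => /eqP; rewrite addr0 subr0 -natrD pnatr_eq0.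
by [].
Qed.

Lemma hw_annihilator_all b n : Dplus (-1) b -> b != 0 -> rho (-1) b v = 0 ->
  exists f, [/\ Dplus (- n.+1%:Z) f, f != 0 & rho (- n.+1%:Z) f v = 0].
Proof.
move=> Db b0 bv0; elim: n => [|n [f [Df f0 fv0]]]; first by exists b.
have -> : - n.+2%:Z = -1 + - n.+1%:Z by lia.
by apply: (hw_annihilator_step _ Db b0 bv0 Df f0 fv0); lia.
Qed.

(** Division by [f] leaves a remainder of bounded degree, and the part divisible by [f] kills
    [v]. *)
Lemma hw_orbit_finite k f : k != 0 -> Dplus k f -> f != 0 -> rho k f v = 0 ->
  exists B : seq V, forall g, Dplus k g -> in_span (fun y => y \in B) (rho k g v).
Proof.
move=> k0 Df f0 fv0; pose T p := rho k (odd_part k p) v.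
exists [seq T 'X^i | i <- index_iota 0 (size f)] => g Dg.
have def_g := divp_eq g f; set q := g %/ f in def_g; set r := g %% f in def_g.
have sz_r : (size r < size f)%N by rewrite ltn_modp.
have sz_refl : size (refl k) = 2.
  by rewrite -opprD size_polyN size_XaddC.
(* Reflecting g = q f + r gives another division of [g] by [f]; uniqueness fixes the symmetry of
   quotient and remainder. *)
have [q_even r_odd] : q \Po refl k = q /\ - (r \Po refl k) = r.
  apply: divp_modpP.
    rewrite -[LHS]opprK -Dg {1}def_g comp_polyD comp_polyM Df; ring.
  by rewrite size_polyN size_comp_poly2.
have Dr : Dplus k r by rewrite /Dplus -[in RHS]r_odd opprK.
have -> : rho k g v = T r.
  rewrite def_g -[q * f]scale1r (rho_linl rho_mod) //; last first.
    by rewrite mulrC; apply: Dplus_even_mul.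
  by rewrite mulrC hw_annihilator_mul_even // scaler0 add0r /T odd_part_id.
have -> : r = \sum_(i <- index_iota 0 (size f)) r`_i *: 'X^i.
  rewrite big_mkord -poly_def.
  apply/polyP => i; rewrite coef_poly; case: ltnP => // le_fi.
  by rewrite nth_default // (leq_trans (ltnW sz_r)).
rewrite (lmorph_sum (f := T)); last exact: (rho_odd_part_lin rho_mod).
rewrite big_seq; apply: big_ind => [|x y|i s_i].
- exact: in_span0.
- exact: in_span_add.
by apply/in_span_scale/in_span_gen/map_f.
Qed.

(** On [v], each negative degree has a nonzero annihilator, positive degrees act by 0 and degree 0
    by scalars; the property then spreads to the module generated by [v]. *)
Lemma hw_locally_finite b : Dplus (-1) b -> b != 0 -> rho (-1) b v = 0 ->
  forall x, locally_finite rho x.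
Proof.
move=> Db b0 bv0 x; elim/hw_ind: x => [|a x y||k f x Df].
- exact: (locally_finite0 rho_mod).
- exact: (locally_finite_lin rho_mod).
- move=> k; case: (ltgtP k 0) => [k_lt0|k_gt0|->].
  + have [n def_k] : exists n : nat, k = - n.+1%:Z by exists `|k|.-1; lia.
    have [f [Df f0 fv0]] := hw_annihilator_all n Db b0 bv0.
    rewrite -def_k in Df fv0; apply: hw_orbit_finite fv0 => //; lia.
  + by exists [::] => f Df; rewrite hw_pos //; apply: in_span0.
  + exists [:: v] => f Df; rewrite hw_weight //.
    by apply/in_span_scale/in_span_gen; rewrite inE.
exact: (locally_finite_rho rho_mod).
Qed.

Lemma hw_word_lower w : is_word w ->
  lower_span rho (fun s => exists a : Cx, s = a *: v) (wdeg w) (act rho w v).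
Proof.
elim=> [|p w' Dp _ IHw].
  apply: in_span_gen; exists [::], v; split=> //.
  by exists 1; rewrite scale1r.
rewrite wdeg_cons /=; apply: (lower_span_rho rho_mod rhoC_central) => //.
  by move=> k f _ k0 Df [a ->]; rewrite (rho_Z rho_mod) // hw_pos // scaler0.
move=> f _ Df [a ->]; exists (a * Lambda0 f).
by rewrite (rho_Z rho_mod) // hw_weight // scalerA.
Qed.

Lemma hw_quasifinite b : Dplus (-1) b -> b != 0 -> rho (-1) b v = 0 ->
  quasifinite rho v.
Proof.
move=> Db b0 bv0 j.
have [B hB] := lower_span_finite rho_mod v j (hw_locally_finite Db b0 bv0).
by exists B => w Ww def_j; apply: hB; rewrite -def_j; apply: hw_word_lower.
Qed.

(** The vectors t^{-1} D^{2i+1} v all lie in one finite-dimensional space; a linear relation among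
    them provides [b]. *)
Lemma quasifinite_hw_annihilator : quasifinite rho v ->
  exists b, [/\ Dplus (-1) b, b != 0 & rho (-1) b v = 0].
Proof.
move=> /(_ (-1)) [B hB].
have DX i : Dplus (-1) 'X^(i.*2.+1).
  rewrite Dplus_neg1E rmorphXn /= comp_polyX exprNn -signr_odd /= odd_double.
  exact: mulN1r.
have [i|u [i le_iB ui0] dep] := @linear_dependence Cx V B (fun i => rho (-1) 'X^(i.*2.+1) v).
  apply: in_span_seq_coord; have := hB [:: (-1, 'X^(i.*2.+1))]; apply.
    by constructor=> //; apply: DX.
  by rewrite wdeg_cons wdeg_nil addr0.
pose b := \sum_(i < (size B).+1) u i *: 'X^(i.*2.+1).
have Db : Dplus (-1) b.
  rewrite /b; apply: big_ind => [|f g Df Dg|j _]; first exact: Dplus0.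
    by rewrite -[f]scale1r; apply: Dplus_lin.
  by rewrite -[_ *: _]addr0; apply: Dplus_lin (DX j) (Dplus0 _).
exists b; split=> //.
  apply/eqP => /(congr1 (fun p : {poly Cx} => p`_(i.*2.+1))).
  rewrite coef0 /b coef_sum -ltnS in le_iB *.
  rewrite (bigD1 (Ordinal le_iB)) //= coefZ coefXn eqxx mulr1 big1 ?addr0.
    by move/eqP; rewrite (negPf ui0).
  move=> j; rewrite -val_eqE /= coefZ coefXn eqSS => ne_ji.
  by rewrite (inj_eq double_inj) eq_sym (negPf ne_ji) mulr0.
rewrite -(odd_part_id Db) /b.
rewrite (lmorph_sum (f := fun p => rho (-1) (odd_part (-1) p) v)); last first.
  exact: (rho_odd_part_lin rho_mod).
by rewrite -[RHS]dep; apply: eq_bigr => j _; rewrite odd_part_id.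
Qed.

End HighestWeight.

Theorem mainTheorem4
  (Lambda0 : {poly Cx} -> Cx) (c : Cx)
  (HLambda : forall (a : Cx) f g, Dplus 0 f -> Dplus 0 g ->
               Lambda0 (a *: f + g) = a * Lambda0 f + Lambda0 g)
  (V : lmodType Cx) (rho : int -> {poly Cx} -> V -> V) (rhoC : V -> V) (v : V) :
  is_DhatPlus_module rho rhoC ->
  is_highest_weight_module rho rhoC Lambda0 c v ->
  irreducible_module rho rhoC ->
  (quasifinite rho v <->
   exists F : seq (Cx * {poly Cx}),
     [/\ (forall n, odd n -> qp_coef F n = 0),
         qp_coef F 0 = 0
       & (forall n, \sum_(i < n.+1) DeltaSeries Lambda0 i * sinh2_coef (n - i)
                    = qp_coef F n)]).
Proof.
move=> rho_mod v_hw irr; rewrite -(weight_diff_qpP HLambda); split.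
  case/(quasifinite_hw_annihilator rho_mod) => b [Db b0 bv0].
  by exists b => //; apply: (hw_annihilator_weight_diff rho_mod v_hw HLambda Db bv0).
(* p(X) p(-X) is even, so [b] is an odd nonzero multiple of [p]. *)
case=> p p0 p_ann; pose b := 'X * p * (p \Po - 'X).
have b0 : b != 0.
  rewrite !mulf_neq0 ?polyX_eq0 // -size_poly_gt0 size_comp_poly2 ?size_poly_gt0 //.
  by rewrite size_polyN size_polyX.
have Db : Dplus (-1) b.
  rewrite Dplus_neg1E /b !comp_polyM comp_polyX (comp_affineA p (r := 'X)).
    by rewrite comp_polyXr; ring.
  by rewrite comp_polyN comp_polyX opprK.
apply: (hw_quasifinite rho_mod v_hw Db b0).
apply: (weight_diff_hw_annihilator rho_mod v_hw) => // h.
by rewrite /b -(p_ann ('X * (p \Po - 'X) * h)); congr weight_diff; ring.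
Qed.
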